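(* Assume (QP) has an optimal solution, let $\gamma\in(0,1)$, and let $\tau_p,\tau_d>0$ be problem-dependent error bound constants for (QP) (as defined in the context). Put $C_2=\sqrt{n/\gamma}+n$. Let $$\psi_p=\inf_{x^*\in\Omega_P}\ \min_{i\in\mathcal{I}(x^* )}x_i^*,$$ where $\Omega_P$ is the solution set of the primal problem in (QP), and assume $\psi_p>0$. Fix $C$ and a vector $\lambda\in\mathbb{R}^n$, $\lambda\ge0$, such that $$C=\frac{\psi_p}{2}\quad\text{and}\quad 0<\|\lambda\|<\min\left(1,\ \frac{\psi_p}{16\max(\tau_p,\tau_d)}\right).$$ Let $(x,y,s)\in\mathcal{N}_\lambda(\gamma)$ with $$\mu_\lambda<\min\left(1,\ \left(\frac{\psi_p}{4\max(\tau_p,\tau_d)\,C_2}\right)^2\right).$$ Then there exists an optimal solution $(x^*,y^*,s^* )$ of (QP) such that $$\bar{\mathcal{A}}_C(x)=\mathcal{A}(x^* ).$$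
   Context: Let $H\in\mathbb{R}^{n\times n}$ be symmetric positive semidefinite, $A\in\mathbb{R}^{m\times n}$ with $m\le n$, $b\in\mathbb{R}^m$, $c\in\mathbb{R}^n$. Vector inequalities are componentwise and $\|\cdot\|$ is the Euclidean norm. The pair (QP) consists of the primal problem $\min_x \frac12x^THx+c^Tx$ subject to $Ax=b$, $x\ge0$, and the dual problem $\max_{(x,y,s)} b^Ty-\frac12x^THx$ subject to $A^Ty+s-Hx=c$, $s\ge0$, $y$ free. A triple $(x^*,y^*,s^* )$ is an optimal solution of (QP) if and only if $Ax^*=b$, $A^Ty^*+s^*-Hx^*=c$, $x^*\ge0$, $s^*\ge0$ and $x_i^*s_i^*=0$ for all $i$. For $\lambda\ge0$, $\mathcal{F}^0_\lambda=\{(x,y,s): Ax=b,\ A^Ty+s-Hx=c,\ x+\lambda>0,\ s+\lambda>0\}$. For a triple $(x,y,s)$, $\mu_\lambda=\frac{(x+\lambda)^T(s+\lambda)}{n}$. For $\gamma\in(0,1)$, $\mathcal{N}_\lambda(\gamma)=\{(x,y,s)\in\mathcal{F}^0_\lambda: \gamma\mu_\lambda\le(x_i+\lambda_i)(s_i+\lambda_i)\le\mu_\lambda/\gamma,\ i=1,\dots,n\}$. Problem-dependent error bound constants: $\tau_p,\tau_d>0$ are constants depending only on $(H,A,b,c)$ such that for every $\gamma\in(0,1)$, every $\lambda\ge0$ and every $(x,y,s)\in\mathcal{N}_\lambda(\gamma)$ there is an optimal solution $(x^*,y^*,s^* )$ of (QP) with $\|x-x^*\|<\tau_p\,\beta$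 and $\|s-s^*\|<\tau_d\,\beta$, where $\beta=(\sqrt{n/\gamma}+n)\sqrt{\mu_\lambda}\max(\sqrt{\mu_\lambda},1)+4\|\lambda\|\max(\|\lambda\|,1)$. (Such constants exist when (QP) has an optimal solution.) Sets (with $i$ ranging over $\{1,\dots,n\}$): $\mathcal{A}(x^* )=\{i:x_i^*=0\}$, $\mathcal{I}(x^* )=\{i:x_i^*>0\}$, $\bar{\mathcal{A}}_C(x)=\{i:x_i<C\}$. Convention: a minimum over the empty set is $+\infty$, and quantities involving $\psi_p$ are read in $[0,+\infty]$. *)

(* Defs.v *)
From mathcomp Require Import all_boot all_order all_algebra.
From mathcomp Require Import all_classical all_reals all_analysis.
Set Implicit Arguments.
Unset Strict Implicit.
Unset Printing Implicit Defensive.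
Import Order.TTheory GRing.Theory Num.Theory.
Local Open Scope ring_scope.

(* The norm that MathComp-Analysis puts on matrices is the sup norm, hence
   this separate Euclidean norm. *)
Definition norm2 (R : realType) (n : nat) (v : 'cV[R]_n) : R :=
  Num.sqrt (\sum_(i < n) v i 0 ^+ 2).

Definition dotv (R : realType) (n : nat) (u v : 'cV[R]_n) : R :=
  (u^T *m v) 0 0.

Definition nonneg (R : realType) (n : nat) (v : 'cV[R]_n) : Prop :=
  forall i, 0 <= v i 0.

Definition sym_psd (R : realType) (n : nat) (H : 'M[R]_n) : Prop :=
  H^T = H /\ forall v : 'cV[R]_n, 0 <= dotv v (H *m v).

Definition primal_obj (R : realType) (n : nat) (H : 'M[R]_n) (c x : 'cV[R]_n)
    : R :=
  2^-1 * dotv x (H *m x) + dotv c x.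

Definition primal_feasible (R : realType) (m n : nat) (A : 'M[R]_(m, n))
    (b : 'cV[R]_m) (x : 'cV[R]_n) : Prop :=
  A *m x = b /\ nonneg x.

Definition primal_solution (R : realType) (m n : nat) (H : 'M[R]_n)
    (A : 'M[R]_(m, n)) (b : 'cV[R]_m) (c x : 'cV[R]_n) : Prop :=
  primal_feasible A b x /\
  forall z, primal_feasible A b z -> primal_obj H c x <= primal_obj H c z.

(* Optimality of a triple for the primal-dual pair
     min  x^T H x / 2 + c^T x   s.t.  A x = b, x >= 0,
     max  b^T y - x^T H x / 2   s.t.  A^T y + s - H x = c, s >= 0,
   expressed by feasibility and complementarity. *)
Definition qp_optimal (R : realType) (m n : nat) (H : 'M[R]_n)
    (A : 'M[R]_(m, n)) (b : 'cV[R]_m) (c x : 'cV[R]_n) (y : 'cV[R]_m)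
    (s : 'cV[R]_n) : Prop :=
  [/\ A *m x = b, A^T *m y + s - H *m x = c, nonneg x, nonneg s &
      forall i, x i 0 * s i 0 = 0].

Definition mu (R : realType) (n : nat) (lam x s : 'cV[R]_n) : R :=
  dotv (x + lam) (s + lam) / n%:R.

Definition strictly_feasible (R : realType) (m n : nat) (H : 'M[R]_n)
    (A : 'M[R]_(m, n)) (b : 'cV[R]_m) (c lam x : 'cV[R]_n) (y : 'cV[R]_m)
    (s : 'cV[R]_n) : Prop :=
  [/\ A *m x = b, A^T *m y + s - H *m x = c,
      forall i, 0 < x i 0 + lam i 0 & forall i, 0 < s i 0 + lam i 0].

Definition central_nbhd (R : realType) (m n : nat) (H : 'M[R]_n)
    (A : 'M[R]_(m, n)) (b : 'cV[R]_m) (c lam : 'cV[R]_n) (gamma : R)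
    (x : 'cV[R]_n) (y : 'cV[R]_m) (s : 'cV[R]_n) : Prop :=
  strictly_feasible H A b c lam x y s /\
  forall i, gamma * mu lam x s <= (x i 0 + lam i 0) * (s i 0 + lam i 0)
              <= mu lam x s / gamma.

Definition beta (R : realType) (n : nat) (gamma : R) (lam x s : 'cV[R]_n)
    : R :=
  (Num.sqrt (n%:R / gamma) + n%:R) * Num.sqrt (mu lam x s)
    * Num.max (Num.sqrt (mu lam x s)) 1
  + 4 * norm2 lam * Num.max (norm2 lam) 1.

Definition error_bound_constants (R : realType) (m n : nat) (H : 'M[R]_n)
    (A : 'M[R]_(m, n)) (b : 'cV[R]_m) (c : 'cV[R]_n) (tau_p tau_d : R)
    : Prop :=
  [/\ 0 < tau_p, 0 < tau_d &
      forall (gamma : R) (lam x : 'cV[R]_n) (y : 'cV[R]_m) (s : 'cV[R]_n),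
        0 < gamma < 1 -> nonneg lam -> central_nbhd H A b c lam gamma x y s ->
        exists (xs : 'cV[R]_n) (ys : 'cV[R]_m) (ss : 'cV[R]_n),
          [/\ qp_optimal H A b c xs ys ss,
              norm2 (x - xs) < tau_p * beta gamma lam x s &
              norm2 (s - ss) < tau_d * beta gamma lam x s]].

Definition active_set (R : realType) (n : nat) (x : 'cV[R]_n) : {set 'I_n} :=
  [set i | x i 0 == 0]%SET.

Definition inactive_set (R : realType) (n : nat) (x : 'cV[R]_n)
    : {set 'I_n} :=
  [set i | 0 < x i 0]%SET.

(* The threshold may be [+oo], in which case every index is selected. *)
Definition predicted_active_set (R : realType) (n : nat) (C : \bar R)
    (x : 'cV[R]_n) : {set 'I_n} :=
  [set i | ((x i 0)%:E < C)%E]%SET.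

(* Equal to [+oo] when 0 is the only primal solution. *)
Definition psi_p (R : realType) (m n : nat) (H : 'M[R]_n) (A : 'M[R]_(m, n))
    (b : 'cV[R]_m) (c : 'cV[R]_n) : \bar R :=
  ereal_inf [set (\big[mine/+oo]_(i in inactive_set x) (x i 0)%:E)%E
            | x in [set x | primal_solution H A b c x]%classic]%classic.

(* Main.v *)
(** The bounds on [mu] and [lam] make the error bound [tau_p * beta] smaller
    than [psi_p / 2], so some optimal [xs] is within [psi_p / 2 = C] of [x]
    componentwise.  By convexity [xs] solves the primal problem, hence each of
    its positive entries is at least [psi_p]: the entries of [x] lie below [C]
    where [xs] vanishes and above [C] elsewhere.  If [psi_p = +oo], then
    [xs = 0] and every index is selected on both sides. *)

Require Import Defs.
From mathcomp Require Import all_boot all_order all_algebra.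
From mathcomp Require Import all_classical all_reals all_analysis.
From mathcomp Require Import ring lra.
Set Implicit Arguments.
Unset Strict Implicit.
Unset Printing Implicit Defensive.
Import Order.TTheory GRing.Theory Num.Theory.
Local Open Scope ring_scope.

Lemma dotvE (R : realType) (n : nat) (u v : 'cV[R]_n) :
  dotv u v = \sum_(i < n) u i 0 * v i 0.
Proof. by rewrite /dotv mxE; apply: eq_bigr => i _; rewrite mxE. Qed.

Lemma dotvC (R : realType) (n : nat) (u v : 'cV[R]_n) : dotv u v = dotv v u.
Proof. by rewrite !dotvE; apply: eq_bigr => i _; rewrite mulrC. Qed.

Lemma dotvDr (R : realType) (n : nat) (u v w : 'cV[R]_n) :
  dotv u (v + w) = dotv u v + dotv u w.
Proof. by rewrite /dotv mulmxDr mxE. Qed.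

Lemma dotvBr (R : realType) (n : nat) (u v w : 'cV[R]_n) :
  dotv u (v - w) = dotv u v - dotv u w.
Proof. by rewrite /dotv mulmxBr !mxE. Qed.

Lemma dotvDl (R : realType) (n : nat) (u v w : 'cV[R]_n) :
  dotv (u + v) w = dotv u w + dotv v w.
Proof. by rewrite dotvC dotvDr !(dotvC w). Qed.

Lemma dotvBl (R : realType) (n : nat) (u v w : 'cV[R]_n) :
  dotv (u - v) w = dotv u w - dotv v w.
Proof. by rewrite dotvC dotvBr !(dotvC w). Qed.

Lemma dotv_trmul (R : realType) (m n : nat) (A : 'M[R]_(m, n))
    (u : 'cV[R]_m) (v : 'cV[R]_n) :
  dotv (A^T *m u) v = dotv u (A *m v).
Proof. by rewrite /dotv trmx_mul trmxK mulmxA. Qed.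

(** For feasible [z], dual feasibility and complementarity turn the difference of the objectives at
    [z] and [x] into [(z - x)^T H (z - x) / 2 + s^T z], and both terms are nonnegative. *)
Lemma qp_optimal_primal_solution (R : realType) (m n : nat) (H : 'M[R]_n)
    (A : 'M[R]_(m, n)) (b : 'cV[R]_m) (c x : 'cV[R]_n) (y : 'cV[R]_m)
    (s : 'cV[R]_n) :
  sym_psd H -> qp_optimal H A b c x y s -> primal_solution H A b c x.
Proof.
move=> [HT Hpsd] [Ax dual x0 s0 xs]; split => // z [Az z0].
have sx : dotv s x = 0.
  by rewrite dotvE big1 // => i _; rewrite mulrC xs.
have sz : 0 <= dotv s z by rewrite dotvE sumr_ge0 // => i _; rewrite mulr_ge0.
have Hxz : dotv z (H *m x) = dotv x (H *m z).
  by rewrite dotvC -{1}HT dotv_trmul.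
have := Hpsd (z - x).
rewrite mulmxBr dotvBr !dotvBl Hxz.
(* Pairing the dual equation with [v] eliminates [c]; the terms in [y] then cancel because [A *m x]
   and [A *m z] both equal [b]. *)
have cE (v : 'cV[R]_n) :
    dotv c v = dotv y (A *m v) + dotv s v - dotv x (H *m v).
  by rewrite -dual dotvBl dotvDl dotv_trmul -{1}HT dotv_trmul.
rewrite /primal_obj !cE Ax Az sx; lra.
Qed.

Lemma psi_p_le (R : realType) (m n : nat) (H : 'M[R]_n) (A : 'M[R]_(m, n))
    (b : 'cV[R]_m) (c x : 'cV[R]_n) (i : 'I_n) :
  primal_solution H A b c x -> 0 < x i 0 ->
  (psi_p H A b c <= (x i 0)%:E)%E.
Proof.
move=> xsol xi; apply: (@le_trans _ _
  (\big[mine/+oo%E]_(j in inactive_set x) (x j 0)%:E)).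
  by apply: ereal_inf_lbound; exists x.
by apply: bigmin_le_cond; rewrite inE.
Qed.

Lemma norm2_coord (R : realType) (n : nat) (v : 'cV[R]_n) (i : 'I_n) :
  `|v i 0| <= norm2 v.
Proof.
rewrite -sqrtr_sqr /norm2 ler_sqrt; last first.
  by apply: sumr_ge0 => j _; apply: sqr_ge0.
by rewrite (bigD1 i) //= lerDl sumr_ge0 // => j _; apply: sqr_ge0.
Qed.

(** The threshold [psi / 2] is the midpoint of the gap between zero and positive entries of [xs],
    and an error below half the gap cannot cross it. Keeping [psi] extended covers [+oo] as well. *)
Lemma predicted_active_setP (R : realType) (n : nat) (psi : \bar R)
    (x xs : 'cV[R]_n) :
  nonneg xs -> (0 < psi)%E ->
  (forall i, 0 < xs i 0 -> (psi <= (xs i 0)%:E)%E) ->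
  (forall i, (`|x i 0 - xs i 0|%:E < psi / 2%:E)%E) ->
  predicted_active_set (psi / 2%:E)%E x = active_set xs.
Proof.
move=> xs0 psi0 gap close; apply/setP => i; rewrite !inE.
have [xi0|xi0] := eqVneq (xs i 0) 0.
  apply: le_lt_trans (close i).
  by rewrite xi0 subr0 lee_fin ler_norm.
have {}xi0 : 0 < xs i 0 by rewrite lt_neqAle eq_sym xi0 xs0.
apply/negbTE; rewrite -leNgt.
(* A positive entry of [xs] bounds [psi] from above, so only a finite [psi] survives here. *)
move: psi0 (gap i xi0) (close i) => {gap close}; case: psi => [r| |] //= _.
rewrite inver pnatr_eq0 /= -EFinM !(lte_fin, lee_fin) => rx.
by rewrite ltr_distlC => /andP[]; lra.
Qed.

Theorem theorem8 (R : realType) (m n : nat) (H : 'M[R]_n) (A : 'M[R]_(m, n))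
    (b : 'cV[R]_m) (c : 'cV[R]_n) (gamma tau_p tau_d C2 : R) (C : \bar R)
    (lam x : 'cV[R]_n) (y : 'cV[R]_m) (s : 'cV[R]_n)
    (hmn : (m <= n)%N)
    (hH : sym_psd H)
    (hopt : exists (x0 : 'cV[R]_n) (y0 : 'cV[R]_m) (s0 : 'cV[R]_n),
        qp_optimal H A b c x0 y0 s0)
    (hgamma : 0 < gamma < 1)
    (htau : error_bound_constants H A b c tau_p tau_d)
    (hC2 : C2 = Num.sqrt (n%:R / gamma) + n%:R)
    (hpsi : (0 < psi_p H A b c)%E)
    (hC : C = (psi_p H A b c / 2%:E)%E)
    (hlam : nonneg lam)
    (hlam0 : 0 < norm2 lam)
    (hlam1 : ((norm2 lam)%:E <
              mine 1%:E (psi_p H A b c / (16 * Num.max tau_p tau_d)%:E))%E)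
    (hN : central_nbhd H A b c lam gamma x y s)
    (hmu : ((mu lam x s)%:E <
            mine 1%:E
              ((psi_p H A b c / (4 * Num.max tau_p tau_d * C2)%:E) ^+ 2))%E) :
  exists (xs : 'cV[R]_n) (ys : 'cV[R]_m) (ss : 'cV[R]_n),
    qp_optimal H A b c xs ys ss /\ predicted_active_set C x = active_set xs.
Proof.
have [tp0 _ /(_ gamma lam x y s hgamma hlam hN)] := htau.
move=> [xs [ys [ss [opt dx _]]]].
exists xs, ys, ss; split => //.
have xsol := qp_optimal_primal_solution hH opt.
have [_ _ xs0 _ _] := opt.
rewrite hC; apply: predicted_active_setP => // [i|i]; first exact: psi_p_le.
have {dx} dx : `|x i 0 - xs i 0| < tau_p * beta gamma lam x s.
  by apply: le_lt_trans dx; have := norm2_coord (x - xs) i; rewrite !mxE.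
(* The index [i] itself shows that the dimension is nonzero, which makes [C2] positive. *)
have n0 : (0 < n)%N := leq_ltn_trans (leq0n i) (ltn_ord i).
have /andP[g0 _] := hgamma.
have C20 : 0 < C2.
  by rewrite hC2 ltr_wpDl ?sqrtr_ge0 // ltr0n.
have M0 : 0 < Num.max tau_p tau_d by rewrite lt_max tp0.
have tpM : tau_p <= Num.max tau_p tau_d by rewrite le_max lexx.
move: (Num.max _ _) M0 tpM hlam1 hmu => M M0 tpM.
rewrite !lt_min => /andP[lam1 lamM] /andP[mu1 muM].
rewrite !lte_fin in lam1 mu1.
have smu1 : Num.sqrt (mu lam x s) <= 1 by rewrite -sqrtr1 ler_wsqrtr // ltW.
(* Both maxima in [beta] equal 1, since [mu] and [norm2 lam] are below 1. *)
have betaE : beta gamma lam x s = C2 * Num.sqrt (mu lam x s) + 4 * norm2 lam.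
  by rewrite /beta -hC2 !max_r ?mulr1 // ltW.
(* For [+oo] the half is again [+oo], which exceeds any real distance. *)
case: (psi_p _ _ _ _) hpsi lamM muM => [r| |] //; last first.
  by move=> _ _ _; rewrite inver pnatr_eq0 /= gt0_mulye ?lte_fin ?invr_gt0 ?ltry.
(* The extended inverse treats 0 separately; positivity of [M] and [C2] reduces every bound to a
   quotient of reals. *)
rewrite !inver pnatr_eq0 /= !gt_eqF ?mulr_gt0 //=.
rewrite -!EFinM !lte_fin -expr2 => r0 lamM muM.
have q0 : 0 < r / (4 * M * C2) by rewrite divr_gt0 ?mulr_gt0.
have sq : Num.sqrt (mu lam x s) < r / (4 * M * C2).
  by rewrite -[ltRHS]gtr0_norm // -sqrtr_sqr ltr_sqrt ?exprn_gt0.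
(* The two summands of [M * beta] get equal shares: [r / 4] for the [mu] term and [4 * (r / 16)] for
   the [lam] term, together [r / 2]. *)
have C2mu : M * (C2 * Num.sqrt (mu lam x s)) < r / 4.
  rewrite (_ : r / 4 = M * (C2 * (r / (4 * M * C2)))) ?ltr_pM2l //.
  by field; rewrite !gt_eqF.
have Mlam : M * norm2 lam < r / 16.
  rewrite (_ : r / 16 = M * (r / (16 * M))) ?ltr_pM2l //.
  by field; rewrite gt_eqF.
apply: lt_le_trans dx _; apply: (@le_trans _ _ (M * beta gamma lam x s)).
  rewrite ler_wpM2r // betaE addr_ge0 ?mulr_ge0 ?sqrtr_ge0 //; exact: ltW.
by rewrite betaE; lra.
Qed.
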